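(* Let $p \in \mathbb{N}$, let $\mathbf{X} = (X_1,\dots,X_p)$ be an $\mathbb{R}^p$-valued random vector and let $Y$ be a real-valued random variable on a common probability space, such that $Y$ and at least one coordinate of $\mathbf{X}$ are non-degenerate. Let $(Y,Y')$ be the Markov product of $(\mathbf{X},Y)$, i.e. $Y'$ is a conditionally independent copy of $Y$ given $\mathbf{X}$. Then the following statements are equivalent: (a) $\Lambda(Y|\mathbf{X}) = 0$. (b) $Y$ is stochastically comparable relative to $\mathbf{X}$. (c) The probability of concordance of $(Y,Y')$ coincides with the probability of discordance of $(Y,Y')$, i.e. $\mathbb{P}\big((Y_1 - Y_2)(Y_1' - Y_2') > 0\big) = \mathbb{P}\big((Y_1 - Y_2)(Y_1' - Y_2') < 0\big)$, where $(Y_1,Y_1')$ and $(Y_2,Y_2')$ denote independent copies of $(Y,Y')$.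
   Context: Markov product: $Y'$ is a random variable such that, for $\mathbb{P}^{\mathbf{X}}$-almost all $\mathbf{x} \in \mathbb{R}^p$, the conditional distribution of $Y'$ given $\mathbf{X}=\mathbf{x}$ equals the conditional distribution of $Y$ given $\mathbf{X}=\mathbf{x}$, and $Y$ and $Y'$ are conditionally independent given $\mathbf{X}$. The pair $(Y,Y')$ is called the Markov product of $(\mathbf{X},Y)$. Notation: $\mathbb{P}^Z$ denotes the distribution of $Z$, and $\mathbb{P}^{Y|\mathbf{X}=\mathbf{x}}$ the (regular) conditional distribution of $Y$ given $\mathbf{X}=\mathbf{x}$. Non-degenerate means not almost surely constant. Relative effect: for real random variables $Z_1, Z_2$, $$\Psi(\mathbb{P}^{Z_1},\mathbb{P}^{Z_2}) := \int_{\mathbb{R}} \Big(\mathbb{P}(Z_1 < z) + \tfrac12 \mathbb{P}(Z_1 = z)\Big) \, d\mathbb{P}^{Z_2}(z).$$ Coefficient of separation: for $Y$ and at least one coordinate of $\mathbf{X}$ non-degenerate, $$\Lambda(Y|\mathbf{X}) := \frac{4}{1-\mathbb{P}(\mathbf{X}=\mathbf{X}^\ast)} \int_{\mathbb{R}^p\times\mathbb{R}^p} \Big(\Psi\big(\mathbb{P}^{Y|\mathbf{X}=\mathbf{x}_1},\mathbb{P}^{Y|\mathbf{X}=\mathbf{x}_2}\big) - \tfrac12\Big)^2 \, d(\mathbb{P}^{\mathbf{X}}\otimes\mathbb{P}^{\mathbf{X}})(\mathbf{x}_1,\mathbf{x}_2),$$ where $\mathbf{X}^\ast$ is an independent copy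 of $\mathbf{X}$. Stochastic comparability: $Y$ is stochastically comparable relative to $\mathbf{X}$ if $\Psi\big(\mathbb{P}^{Y|\mathbf{X}=\mathbf{x}_1},\mathbb{P}^{Y|\mathbf{X}=\mathbf{x}_2}\big) = 1/2$ for ($\mathbb{P}^{\mathbf{X}}\otimes\mathbb{P}^{\mathbf{X}}$-)almost all $(\mathbf{x}_1,\mathbf{x}_2)$ with $\mathbf{x}_1\neq\mathbf{x}_2$. *)

(* Defs.v *)
From mathcomp Require Import all_boot all_order all_algebra.
From mathcomp Require Import all_classical all_reals all_analysis.

Set Implicit Arguments.
Unset Strict Implicit.
Unset Printing Implicit Defensive.
Import Order.TTheory GRing.Theory Num.Theory.
Import numFieldNormedType.Exports.
Local Open Scope classical_set_scope.
Local Open Scope ring_scope.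

Definition degenerate d (T : measurableType d) (R : realType)
    (P : probability T R) (Z : T -> R) : Prop :=
  exists c : R, {ae P, forall t, Z t = c}.

Definition same_distribution d1 (T1 : measurableType d1)
    d2 (T2 : measurableType d2) d (U : measurableType d) (R : realType)
    (P : probability T1 R) (Q : probability T2 R)
    (Z : T1 -> U) (W : T2 -> U) : Prop :=
  forall A : set U, measurable A -> P (Z @^-1` A) = Q (W @^-1` A).

Definition independent d (T : measurableType d) d1 (U : measurableType d1)
    d2 (V : measurableType d2) (R : realType) (P : probability T R)
    (Z : T -> U) (W : T -> V) : Prop :=
  forall (A : set U) (B : set V), measurable A -> measurable B ->
    P (Z @^-1` A `&` W @^-1` B) = (P (Z @^-1` A) * P (W @^-1` B))%E.

(* [f] is a version of the conditional probability x |-> P (E | X = x). *)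
Definition is_cond_prob d (T : measurableType d) d' (T' : measurableType d')
    (R : realType) (P : probability T R) (X : {RV P >-> T'})
    (E : set T) (f : T' -> R) : Prop :=
  (distribution P X).-integrable [set: T'] (EFin \o f) /\
  forall A : set T', measurable A ->
    P (X @^-1` A `&` E) = (\int[distribution P X]_(x in A) (f x)%:E)%E.

(* [k] is a version of the regular conditional distribution of [Y] given [X];
   versions are unique only up to a [distribution P X]-null set. *)
Definition is_cond_distribution d (T : measurableType d)
    d' (T' : measurableType d') (R : realType) (P : probability T R)
    (X : {RV P >-> T'}) (Y : {RV P >-> R}) (k : R.-pker T' ~> R) : Prop :=
  forall B : set R, measurable B ->
    is_cond_prob X (Y @^-1` B) (fun x => fine (k x B)).

(* P (Y \in B, Y' \in C | X) = P (Y \in B | X) P (Y' \in C | X) a.s.; the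
   factors always have versions [f] and [g], unique up to null sets. *)
Definition cond_independent d (T : measurableType d)
    d' (T' : measurableType d') (R : realType) (P : probability T R)
    (X : {RV P >-> T'}) (Y Y' : {RV P >-> R}) : Prop :=
  forall (B C : set R) (f g : T' -> R), measurable B -> measurable C ->
    is_cond_prob X (Y @^-1` B) f -> is_cond_prob X (Y' @^-1` C) g ->
    is_cond_prob X (Y @^-1` B `&` Y' @^-1` C) (fun x => f x * g x).

(* The two conditional laws are compared on measurable sets only: a measure is
   unconstrained on the other sets. *)
Definition markov_product d (T : measurableType d)
    d' (T' : measurableType d') (R : realType) (P : probability T R)
    (X : {RV P >-> T'}) (Y Y' : {RV P >-> R}) : Prop :=
  (exists k k' : R.-pker T' ~> R,
     [/\ is_cond_distribution X Y k, is_cond_distribution X Y' k' &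
         {ae distribution P X, forall x,
            forall B : set R, measurable B -> k' x B = k x B}]) /\
  cond_independent X Y Y'.

Definition relative_effect (R : realType)
    (mu nu : {measure set R -> \bar R}) : R :=
  fine (\int[nu]_z (mu [set w | (w < z)%R] + (1 / 2)%:E * mu [set z]))%E.

(* The law of (X, X^* ) for an independent copy X^* of X is the product of the
   law of X with itself, whence P (X = X^* ) is the mass of the diagonal. *)
Definition separation_coef d (T : measurableType d) (R : realType) (p : nat)
    (P : probability T R) (X : {RV P >-> p.-tuple R})
    (k : R.-pker (p.-tuple R) ~> R) : R :=
  let PXX := (distribution P X \x distribution P X)%E in
  4 / (1 - fine (PXX [set x | x.1 = x.2])) *
  \int[PXX]_x (relative_effect (k x.1) (k x.2) - 1 / 2) ^+ 2.

Definition stochastically_comparable d (T : measurableType d) (R : realType)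
    (p : nat) (P : probability T R) (X : {RV P >-> p.-tuple R})
    (k : R.-pker (p.-tuple R) ~> R) : Prop :=
  {ae (distribution P X \x distribution P X)%E, forall x, x.1 <> x.2 ->
     relative_effect (k x.1) (k x.2) = 1 / 2}.

(* Main.v *)
From HB Require Import structures.
Require Import Defs.
From mathcomp Require Import all_boot all_order all_algebra.
From mathcomp Require Import all_classical all_reals all_analysis.
From mathcomp Require Import measurable_realfun lra ring.
Set Implicit Arguments.
Unset Strict Implicit.
Unset Printing Implicit Defensive.
Import Order.TTheory GRing.Theory Num.Theory.
Import numFieldNormedType.Exports.
Local Open Scope classical_set_scope.
Local Open Scope ring_scope.
Local Open Scope ereal_scope.

(** Write mu for the law of X and, for x = (x1, x2), let Z1 and Z2 be
    independent with laws k x1 and k x2.  Put l x = P (Z1 < Z2) and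
    g x = P (Z1 > Z2).  Since l x + P (Z1 = Z2) + g x = 1, the relative effect
    satisfies Psi - 1/2 = (l - g) / 2 ([relative_effect_half]); in particular
    it vanishes for x1 = x2, by symmetry.

    Conditional independence says that the law nu of (Y, Y') is the mixture
    over mu of the products k x \x k x ([markov_product_law]).  Hence
    nu \x nu is the mixture over mu \x mu of the products
    (k x1 \x k x1) \x (k x2 \x k x2) ([product_of_mixturesE]).  Under such a
    product the pairs (Y1, Y2) and (Y1', Y2') are independent, each with law
    k x1 \x k x2 ([product_measure_shuffle]), so that concordance has
    probability l^2 + g^2 and discordance 2 l g.  The difference of the two
    probabilities is therefore the integral of (l - g)^2 = 4 (Psi - 1/2)^2
    over mu \x mu ([concordance_eq_discordance]).

    Thus each of the three statements says that Psi = 1/2 holds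
    (mu \x mu)-almost everywhere: the concordance statement by the formula
    just given; the vanishing of the coefficient of separation because its
    prefactor is not zero, X having no atom of mass one ([diagonal_neq1]); and
    stochastic comparability because Psi = 1/2 on the diagonal anyway. *)

(** * Probability kernels: pullbacks, products and mixtures *)

(** A kernel application carries no probability structure of its own; this
    constant does, which makes the product-measure theory apply to k x. *)
Definition klaw {d d'} {U : measurableType d} {V : measurableType d'}
  {R : realType} (k : R.-pker U ~> V) (x : U) : set V -> \bar R := k x.

HB.instance Definition _ d d' (U : measurableType d) (V : measurableType d')
  (R : realType) (k : R.-pker U ~> V) (x : U) :=
  Measure.on (klaw k x).

HB.instance Definition _ d d' (U : measurableType d) (V : measurableType d')
  (R : realType) (k : R.-pker U ~> V) (x : U) :=
  Measure_isProbability.Build _ _ _ (klaw k x) (prob_kernel x).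

Definition kpull {d0 d d'} {U0 : measurableType d0} {U : measurableType d}
  {V : measurableType d'} {R : realType} (f : U0 -> U)
  (mf : measurable_fun [set: U0] f) (k : R.-pker U ~> V) :
  U0 -> {measure set V -> \bar R} := fun x => k (f x).

Lemma measurable_kpull d0 d d' (U0 : measurableType d0) (U : measurableType d)
  (V : measurableType d') (R : realType) (f : U0 -> U)
  (mf : measurable_fun [set: U0] f) (k : R.-pker U ~> V) (B : set V) :
  measurable B -> measurable_fun [set: U0] (kpull mf k ^~ B).
Proof.
move=> mB.
exact: (measurableT_comp (f := fun x => k x B) (measurable_kernel k B mB) mf).
Qed.

HB.instance Definition _ d0 d d' (U0 : measurableType d0)
  (U : measurableType d) (V : measurableType d') (R : realType)
  (f : U0 -> U) (mf : measurable_fun [set: U0] f) (k : R.-pker U ~> V) :=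
  isKernel.Build _ _ _ _ _ (kpull mf k) (measurable_kpull mf k).

HB.instance Definition _ d0 d d' (U0 : measurableType d0)
  (U : measurableType d) (V : measurableType d') (R : realType)
  (f : U0 -> U) (mf : measurable_fun [set: U0] f) (k : R.-pker U ~> V) :=
  Kernel_isProbability.Build _ _ _ _ _ (kpull mf k)
    (fun x => prob_kernel (f x)).

(** Fibrewise product, that is, the conditional law of a pair of variables that
    are conditionally independent. *)
Definition kprod {d d1 d2} {U : measurableType d} {V : measurableType d1}
  {W : measurableType d2} {R : realType} (k : R.-pker U ~> V)
  (l : R.-pker U ~> W) : U -> {measure set (V * W) -> \bar R} :=
  fun x => klaw k x \x klaw l x.

(** By definition the product measure of B is the integral over y of the mass
    of the section of B at y, so measurability in the parameter is needed
    twice: for the kernel l seen as depending on (x, y), then for k. *)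
Lemma measurable_kprod d d1 d2 (U : measurableType d) (V : measurableType d1)
  (W : measurableType d2) (R : realType) (k : R.-pker U ~> V)
  (l : R.-pker U ~> W) (B : set (V * W)) : measurable B ->
  measurable_fun [set: U] (kprod k l ^~ B).
Proof.
move=> mB; rewrite /kprod/= /product_measure1/=.
apply: (measurable_fun_integral_finite_kernel
  (fun z : U * V => l z.1 (xsection B z.2)) k) => //=.
pose B' : set (U * V * W) := (fun z => (z.1.2, z.2)) @^-1` B.
have mf : measurable_fun [set: U * V * W] (fun z => (z.1.2, z.2)).
  apply: measurable_fun_pair => //.
  exact: (measurableT_comp measurable_snd measurable_fst).
have mB' : measurable B' by rewrite -[B']setTI; exact: mf.
have := @measurable_fun_xsection_finite_kernel _ _ _ _ _
  (kpull measurable_fst l) B'.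
rewrite inE => /(_ mB').
by congr (measurable_fun _ _); apply/funext => -[x y].
Qed.

HB.instance Definition _ d d1 d2 (U : measurableType d)
  (V : measurableType d1) (W : measurableType d2) (R : realType)
  (k : R.-pker U ~> V) (l : R.-pker U ~> W) :=
  isKernel.Build _ _ _ _ _ (kprod k l) (measurable_kprod k l).

Lemma kprod_setT d d1 d2 (U : measurableType d)
  (V : measurableType d1) (W : measurableType d2) (R : realType)
  (k : R.-pker U ~> V) (l : R.-pker U ~> W) x : kprod k l x setT = 1.
Proof. exact: (probability_setT (klaw k x \x klaw l x)). Qed.

HB.instance Definition _ d d1 d2 (U : measurableType d)
  (V : measurableType d1) (W : measurableType d2) (R : realType)
  (k : R.-pker U ~> V) (l : R.-pker U ~> W) :=
  Kernel_isProbability.Build _ _ _ _ _ (kprod k l) (kprod_setT k l).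

(** The image of m under the kernel k.  Composing k with the constant kernel m
    on unit makes it a measure. *)
Definition mixture {d d'} {U : measurableType d} {V : measurableType d'}
  {R : realType} (m : probability U R) (k : R.-pker U ~> V) :
  {measure set V -> \bar R} :=
  mkcomp_noparam (kprobability (measurable_cst (m : pprobability U R))
    : R.-pker unit ~> U) k tt.

Lemma mixtureE d d' (U : measurableType d) (V : measurableType d')
  (R : realType) (m : probability U R) (k : R.-pker U ~> V) A :
  mixture m k A = \int[m]_x k x A.
Proof. by []. Qed.

(** * Product measures *)

Lemma probability_fin_num d (V : measurableType d) (R : realType)
  (m : probability V R) (A : set V) : measurable A -> m A \is a fin_num.
Proof. by move=> mA; rewrite fin_num_measure. Qed.

Lemma ge0_integral_prodM d1 d2 (V : measurableType d1) (W : measurableType d2)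
  (R : realType) (m1 : probability V R) (m2 : probability W R)
  (f : V -> \bar R) (g : W -> \bar R) :
  measurable_fun [set: V] f -> measurable_fun [set: W] g ->
  (forall x, 0 <= f x) -> (forall y, 0 <= g y) ->
  \int[m1 \x m2]_z (f z.1 * g z.2) = \int[m1]_x f x * \int[m2]_y g y.
Proof.
move=> mf mg f0 g0; rewrite fubini_tonelli1/=; last 2 first.
- apply: emeasurable_funM.
    exact: (measurableT_comp mf measurable_fst).
  exact: (measurableT_comp mg measurable_snd).
- by move=> z; exact: mule_ge0.
under eq_integral do rewrite /fubini_F/= ge0_integralZl//.
by rewrite ge0_integralZr//; exact: integral_ge0.
Qed.

(** Tonelli, with one measure built from the sections in x and the other from
    the sections in y. *)
Lemma product_measure_swap d1 d2 (V : measurableType d1)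
  (W : measurableType d2) (R : realType) (m1 : probability V R)
  (m2 : probability W R) (A : set (V * W)) : measurable A ->
  (m2 \x m1) [set w | A (w.2, w.1)] = (m1 \x m2) A.
Proof.
move=> mA; rewrite [RHS](product_measure_unique (m' := m1 \x^ m2))//.
by move=> B C mB mC; rewrite /= product_measure2E.
Qed.

(** In (m1 \x m1) \x (m2 \x m2) the first coordinates form a pair that is
    independent of the pair of second coordinates, and both have law m1 \x m2:
    the section at a point is a rectangle, whose mass factors. *)
Lemma product_measure_shuffle d1 d2 (V : measurableType d1)
  (W : measurableType d2) (R : realType) (m1 : probability V R)
  (m2 : probability W R) (A B : set (V * W)) :
  measurable A -> measurable B ->
  ((m1 \x m1) \x (m2 \x m2))
    [set z | A (z.1.1, z.2.1) /\ B (z.1.2, z.2.2)] =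
  (m1 \x m2) A * (m1 \x m2) B.
Proof.
move=> mA mB; rewrite {1}/product_measure1.
transitivity (\int[m1 \x m1]_z (m2 (xsection A z.1) * m2 (xsection B z.2))).
  apply: eq_integral => z _ /=.
  rewrite -product_measure1E; [|exact: measurable_xsection..].
  congr (_ \x _); apply/seteqP.
  by split => w /=; rewrite /xsection/= !inE.
rewrite (@ge0_integral_prodM _ _ _ _ _ m1 m1
  (m2 \o xsection A) (m2 \o xsection B))//.
- exact: measurable_fun_xsection.
- exact: measurable_fun_xsection.
Qed.

Lemma measurable_shuffle d1 d2 (V : measurableType d1) (W : measurableType d2)
  (A B : set (V * W)) : measurable A -> measurable B ->
  measurable [set z : (V * V) * (W * W) |
    A (z.1.1, z.2.1) /\ B (z.1.2, z.2.2)].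
Proof.
move=> mA mB; apply: measurableI.
  have mf : measurable_fun [set: (V * V) * (W * W)]
      (fun z => (z.1.1, z.2.1)).
    apply: measurable_fun_pair.
      exact: (measurableT_comp measurable_fst measurable_fst).
    exact: (measurableT_comp measurable_fst measurable_snd).
  by rewrite -[X in measurable X]setTI; exact: mf.
have mf : measurable_fun [set: (V * V) * (W * W)]
    (fun z => (z.1.2, z.2.2)).
  apply: measurable_fun_pair.
    exact: (measurableT_comp measurable_snd measurable_fst).
  exact: (measurableT_comp measurable_snd measurable_snd).
by rewrite -[X in measurable X]setTI; exact: mf.
Qed.

(** Two shuffled rectangles, disjoint by their first coordinates: the shape of
    both concordance and discordance. *)
Lemma product_measure_shuffleU d1 d2 (V : measurableType d1)
  (W : measurableType d2) (R : realType) (m1 : probability V R)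
  (m2 : probability W R) (A B C D : set (V * W)) :
  measurable A -> measurable B -> measurable C -> measurable D ->
  A `&` C = set0 ->
  ((m1 \x m1) \x (m2 \x m2))
    ([set z | A (z.1.1, z.2.1) /\ B (z.1.2, z.2.2)] `|`
     [set z | C (z.1.1, z.2.1) /\ D (z.1.2, z.2.2)]) =
  (m1 \x m2) A * (m1 \x m2) B + (m1 \x m2) C * (m1 \x m2) D.
Proof.
move=> mA mB mC mD AC0.
pose m11 : probability (V * V)%type R := m1 \x m1.
pose m22 : probability (W * W)%type R := m2 \x m2.
pose m : probability (V * V * (W * W))%type R := m11 \x m22.
rewrite -[LHS]/(m _) measureU; [|exact: measurable_shuffle..|].
  by congr (_ + _); exact: product_measure_shuffle.
apply/seteqP; split => // z [/= [Az _] [Cz _]].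
by rewrite -[False]/(set0 (z.1.1, z.2.1)) -AC0.
Qed.

(** Measurable rectangles are closed under intersection and generate the
    product sigma-algebra. *)
Lemma measure_eq_rectangles d1 d2 (V : measurableType d1)
  (W : measurableType d2) (R : realType)
  (m1 : probability (V * W)%type R) (m2 : {measure set (V * W) -> \bar R}) :
  (forall A B, measurable A -> measurable B ->
    m1 (A `*` B) = m2 (A `*` B)) ->
  forall C, measurable C -> m1 C = m2 C.
Proof.
move=> m12 C mC.
apply: (measure_unique [set A `*` B | A in measurable & B in measurable]
  (fun=> setT)) => //.
- exact: measurable_prod_measurableType.
- move=> _ _ [A1 mA1 [B1 mB1 <-]] [A2 mA2 [B2 mB2 <-]].
  exists (A1 `&` A2); first exact: measurableI.
  by exists (B1 `&` B2); [exact: measurableI|rewrite setXI].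
- by move=> n; exists setT => //; exists setT => //; rewrite setXTT.
- by rewrite bigcup_const//; exists 0%N.
- by move=> _ [A mA [B mB <-]]; exact: m12.
- by move=> _; rewrite (le_lt_trans (probability_le1 m1 measurableT))// ltry.
Qed.

(** This identifies an independent coupling as a mixture without any
    computation of integrals: rectangles determine the product measure. *)
Lemma mixture_unique d1 d2 d (V : measurableType d1)
  (W : measurableType d2) (U : measurableType d) (R : realType)
  (n1 : probability V R) (n2 : probability W R)
  (m : probability U R) (k : R.-pker U ~> (V * W)%type) :
  (forall A B, measurable A -> measurable B ->
     \int[m]_x k x (A `*` B) = n1 A * n2 B) ->
  forall C, measurable C -> (n1 \x n2) C = \int[m]_x k x C.
Proof.
move=> H C mC.
by rewrite (product_measure_unique (m' := mixture m k)).
Qed.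

(** The product of two mixtures is a mixture of products.  On rectangles this
    is the fact that the integral of a product of functions of separate
    variables factors. *)
Lemma product_of_mixturesE d1 d2 d3 d4 (U1 : measurableType d1)
  (U2 : measurableType d2) (V : measurableType d3) (W : measurableType d4)
  (R : realType) (m1 : probability U1 R) (m2 : probability U2 R)
  (k1 : R.-pker U1 ~> V) (k2 : R.-pker U2 ~> W)
  (n1 : probability V R) (n2 : probability W R) :
  (forall A, measurable A -> n1 A = \int[m1]_x k1 x A) ->
  (forall A, measurable A -> n2 A = \int[m2]_x k2 x A) ->
  forall C, measurable C ->
  (n1 \x n2) C =
  \int[m1 \x m2]_x (klaw k1 x.1 \x klaw k2 x.2) C.
Proof.
move=> n1E n2E C mC.
pose K := kprod (kpull (@measurable_fst _ _ U1 U2) k1)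
                (kpull (@measurable_snd _ _ U1 U2) k2).
apply: (mixture_unique (k := K)) => // A B mA mB.
transitivity (\int[m1 \x m2]_x (k1 x.1 A * k2 x.2 B)).
  apply: eq_integral => x _.
  exact: (product_measure1E (klaw k1 x.1) (klaw k2 x.2)).
rewrite n1E// n2E//.
by apply: (@ge0_integral_prodM _ _ _ _ _ m1 m2 (k1 ^~ A) (k2 ^~ B)) => //;
  exact: measurable_kernel.
Qed.

Lemma integral_sqr_eq0 d (V : measurableType d) (R : realType)
  (m : probability V R) (f : V -> R) : measurable_fun [set: V] f ->
  \int[m]_x ((f x) ^+ 2)%:E = 0 <-> {ae m, forall x, f x = 0%R}.
Proof.
move=> mf.
have mf2 : measurable_fun [set: V] (fun x => (f x ^+ 2)%:E).
  by apply/measurable_EFinP; exact: measurable_funX.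
rewrite (eq_integral (fun x => `|((f x) ^+ 2)%:E|)); last first.
  by move=> x _; rewrite gee0_abs// lee_fin sqr_ge0.
rewrite ae_eq_integral_abs//; split; apply: filterS => x /=.
  by move=> /(_ I) [] /eqP; rewrite sqrf_eq0 => /eqP.
by move=> -> _; rewrite expr0n.
Qed.

(** * The relative effect *)

Definition lt_pairs (R : realType) : set (R * R) := [set w | (w.1 < w.2)%R].
Definition gt_pairs (R : realType) : set (R * R) := [set w | (w.2 < w.1)%R].
Definition eq_pairs (R : realType) : set (R * R) := [set w | w.1 = w.2].

Lemma measurable_lt_pairs (R : realType) : measurable (@lt_pairs R).
Proof.
have := @measurable_fun_ltr _ _ R [set: R * R] fst snd
  measurable_fst measurable_snd measurableT [set true] I.
by rewrite setTI.
Qed.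

Lemma measurable_gt_pairs (R : realType) : measurable (@gt_pairs R).
Proof.
have := @measurable_fun_ltr _ _ R [set: R * R] snd fst
  measurable_snd measurable_fst measurableT [set true] I.
by rewrite setTI.
Qed.

Lemma measurable_eq_pairs (R : realType) : measurable (@eq_pairs R).
Proof.
have := @measurable_fun_eqr _ _ R [set: R * R] fst snd
  measurable_fst measurable_snd measurableT [set true] I.
rewrite setTI; congr measurable; apply/seteqP.
by split => w /=; rewrite /eq_pairs/= => /eqP.
Qed.

Lemma product_measure_trichotomy (R : realType) (m1 m2 : probability R R) :
  (m1 \x m2) (@lt_pairs R) + (m1 \x m2) (@eq_pairs R) +
    (m1 \x m2) (@gt_pairs R) = 1.
Proof.
rewrite -(probability_setT (m1 \x m2)).
rewrite -measureU; [|exact: measurable_lt_pairs|exact: measurable_eq_pairs|].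
  rewrite -measureU.
  - congr (_ \x _); apply/seteqP; split => // -[a b] _ /=.
    rewrite /lt_pairs /eq_pairs /gt_pairs/=.
    by case: (ltgtP a b) => ?; [left; left|right|left; right].
  - apply: measurableU; first exact: measurable_lt_pairs.
    exact: measurable_eq_pairs.
  - exact: measurable_gt_pairs.
  - apply/seteqP; split => // -[a b] /=.
    rewrite /lt_pairs /eq_pairs /gt_pairs/= => -[[ab|->]]; rewrite ?ltxx//.
    by move/(lt_trans ab); rewrite ltxx.
apply/seteqP; split => // -[a b] /=.
by rewrite /lt_pairs /eq_pairs /= => -[+ ab]; rewrite ab ltxx.
Qed.

(** The integrand of the relative effect is made of the masses of sections, so
    its integral is a product measure, up to the order of the factors. *)
Lemma relative_effectE (R : realType) (m1 m2 : probability R R) :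
  relative_effect m1 m2 =
  (fine ((m1 \x m2) (@lt_pairs R)) + 1 / 2 * fine ((m1 \x m2) (@eq_pairs R)))%R.
Proof.
have mlt := @measurable_lt_pairs R; have meq := @measurable_eq_pairs R.
have mlt' : measurable [set w : R * R | @lt_pairs R (w.2, w.1)].
  exact: measurable_gt_pairs.
have meq' : measurable [set w : R * R | @eq_pairs R (w.2, w.1)].
  rewrite (_ : mkset _ = @eq_pairs R); first exact: measurable_eq_pairs.
  by apply/seteqP; split => w /=; rewrite /eq_pairs/= => ->.
rewrite /relative_effect.
rewrite -[X in fine X]/(\int[m2]_z
  (m1 [set w | (w < z)%R] + (1 / 2)%:E * m1 [set z])).
have -> : (fun z => m1 [set w | (w < z)%R] + (1 / 2)%:E * m1 [set z]) =
  (fun z => m1 (xsection [set w : R * R | @lt_pairs R (w.2, w.1)] z) +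
   (1 / 2)%:E * m1 (xsection [set w : R * R | @eq_pairs R (w.2, w.1)] z)).
  apply/funext => z; congr (m1 _ + _ * m1 _);
    by apply/seteqP; split => w; rewrite /xsection/= inE.
have mx (A : set (R * R)) : measurable A ->
    measurable_fun [set: R] (fun z => m1 (xsection A z)).
  by move=> mA; exact: measurable_fun_xsection.
rewrite ge0_integralD//=.
- rewrite ge0_integralZl//; last exact: mx.
  rewrite -[X in X + _]/((m2 \x m1) [set w | @lt_pairs R (w.2, w.1)]).
  rewrite -[X in _ * X]/((m2 \x m1) [set w | @eq_pairs R (w.2, w.1)]).
  have flt : (m1 \x m2) (@lt_pairs R) \is a fin_num.
    exact: probability_fin_num.
  have feq : (m1 \x m2) (@eq_pairs R) \is a fin_num.
    exact: probability_fin_num.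
  by rewrite !product_measure_swap// fineD ?fineM ?fin_numM.
- exact: mx.
- by move=> z _; rewrite mule_ge0// lee_fin.
- by apply: measurable_funeM; exact: mx.
Qed.

(** P (Z1 = Z2) / 2 is eliminated by means of
    P (Z1 < Z2) + P (Z1 = Z2) + P (Z1 > Z2) = 1. *)
Lemma relative_effect_half (R : realType) (m1 m2 : probability R R) :
  (relative_effect m1 m2 - 1 / 2 =
   (fine ((m1 \x m2) (@lt_pairs R)) - fine ((m1 \x m2) (@gt_pairs R))) / 2)%R.
Proof.
rewrite relative_effectE.
move: (probability_fin_num (m1 \x m2) (@measurable_lt_pairs R))
  (probability_fin_num (m1 \x m2) (@measurable_eq_pairs R))
  (probability_fin_num (m1 \x m2) (@measurable_gt_pairs R))
  (product_measure_trichotomy m1 m2).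
move: ((m1 \x m2) _) ((m1 \x m2) _) ((m1 \x m2) _).
by move=> [a| |] [b| |] [c| |]// _ _ _ [] /= abc; lra.
Qed.

(** Exchanging the two equal factors turns Z1 < Z2 into Z2 < Z1. *)
Lemma relative_effect_refl (R : realType) (m : probability R R) :
  relative_effect m m = (1 / 2)%R.
Proof.
apply/eqP; rewrite -subr_eq0 relative_effect_half.
rewrite -(product_measure_swap m m (@measurable_lt_pairs R)).
by rewrite [X in (_ X - _)%R](_ : _ = (m \x m) (@gt_pairs R))// subrr mul0r.
Qed.

Lemma lt_gt_pairs_disjoint (R : realType) : @lt_pairs R `&` @gt_pairs R = set0.
Proof.
apply/seteqP; split => // w []; rewrite /lt_pairs /gt_pairs /= => ab.
by move/(lt_trans ab); rewrite ltxx.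
Qed.

Lemma measurable_relative_effect d (U : measurableType d) (R : realType)
  (k : R.-pker U ~> R) :
  measurable_fun [set: U * U]
    (fun x => relative_effect (k x.1) (k x.2) - 1 / 2)%R.
Proof.
pose K := kprod (kpull (@measurable_fst _ _ U U) k)
                (kpull (@measurable_snd _ _ U U) k).
rewrite (_ : (fun _ => _) = (fun x =>
  (fine (K x (@lt_pairs R)) - fine (K x (@gt_pairs R))) / 2)%R); last first.
  by apply/funext => x; exact: (relative_effect_half (klaw k x.1) (klaw k x.2)).
apply: measurable_funM => //; apply: measurable_funB;
  apply: measurableT_comp => //; apply: measurable_kernel.
- exact: measurable_lt_pairs.
- exact: measurable_gt_pairs.
Qed.

(** Makes the squared excess over 1/2 integrable. *)
Lemma relative_effect_bound (R : realType) (m1 m2 : probability R R) :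
  (0 <= (relative_effect m1 m2 - 1 / 2) ^+ 2 <= 1)%R.
Proof.
have fine01 A : measurable A -> (0 <= fine ((m1 \x m2) A) <= 1)%R.
  move=> mA; rewrite fine_ge0 ?(measure_ge0 (m1 \x m2))//=.
  rewrite -lee_fin fineK ?(probability_le1 (m1 \x m2))//.
  exact: (probability_fin_num (m1 \x m2)).
rewrite sqr_ge0 relative_effect_half/=.
move: (fine01 _ (@measurable_lt_pairs R)) (fine01 _ (@measurable_gt_pairs R)).
by move: (fine _) (fine _) => a b /andP[? ?] /andP[? ?]; nra.
Qed.

(** * Concordance and discordance *)

Definition concordant (R : realType) : set ((R * R) * (R * R)) :=
  [set z | (z.1.1 - z.2.1) * (z.1.2 - z.2.2) > 0]%R.
Definition discordant (R : realType) : set ((R * R) * (R * R)) :=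
  [set z | (z.1.1 - z.2.1) * (z.1.2 - z.2.2) < 0]%R.

Lemma measurable_diff_prod (R : realType) :
  measurable_fun [set: (R * R) * (R * R)]
    (fun z => (z.1.1 - z.2.1) * (z.1.2 - z.2.2))%R.
Proof.
apply: measurable_funM; apply: measurable_funB.
- exact: (measurableT_comp measurable_fst measurable_fst).
- exact: (measurableT_comp measurable_fst measurable_snd).
- exact: (measurableT_comp measurable_snd measurable_fst).
- exact: (measurableT_comp measurable_snd measurable_snd).
Qed.

Lemma measurable_concordant (R : realType) : measurable (@concordant R).
Proof.
have := measurable_fun_ltr (measurable_cst (0%R : R))
  (@measurable_diff_prod R) measurableT (_ : measurable [set true]).
by rewrite setTI; exact.
Qed.

Lemma measurable_discordant (R : realType) : measurable (@discordant R).
Proof.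
have := measurable_fun_ltr (@measurable_diff_prod R)
  (measurable_cst (0%R : R)) measurableT (_ : measurable [set true]).
by rewrite setTI; exact.
Qed.

(** Concordance of (a, a') and (b, b') puts the pairs (a, b) and (a', b') in
    the same strict order. *)
Lemma product_concordant (R : realType) (m1 m2 : probability R R) :
  ((m1 \x m1) \x (m2 \x m2)) (@concordant R) =
  (m1 \x m2) (@lt_pairs R) * (m1 \x m2) (@lt_pairs R) +
  (m1 \x m2) (@gt_pairs R) * (m1 \x m2) (@gt_pairs R).
Proof.
have mlt := @measurable_lt_pairs R; have mgt := @measurable_gt_pairs R.
rewrite -(product_measure_shuffleU m1 m2 mlt mlt mgt mgt
  (@lt_gt_pairs_disjoint R)).
congr (_ \x _); apply/seteqP; split => -[[a a'] [b b']];
  rewrite /concordant /lt_pairs /gt_pairs/=.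
- case: (ltgtP a b) => [ab|ab|->]; last by rewrite subrr mul0r ltxx.
  + rewrite nmulr_rgt0 ?subr_lt0// => ab'; by left.
  + rewrite pmulr_rgt0 ?subr_gt0// => ab'; by right.
- move=> [[ab ab']|[ab ab']].
  + by rewrite nmulr_rgt0 ?subr_lt0.
  + by rewrite pmulr_rgt0 ?subr_gt0.
Qed.

(** Discordance of (a, a') and (b, b') puts the pairs (a, b) and (a', b') in
    opposite strict orders. *)
Lemma product_discordant (R : realType) (m1 m2 : probability R R) :
  ((m1 \x m1) \x (m2 \x m2)) (@discordant R) =
  (m1 \x m2) (@lt_pairs R) * (m1 \x m2) (@gt_pairs R) +
  (m1 \x m2) (@gt_pairs R) * (m1 \x m2) (@lt_pairs R).
Proof.
have mlt := @measurable_lt_pairs R; have mgt := @measurable_gt_pairs R.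
rewrite -(product_measure_shuffleU m1 m2 mlt mgt mgt mlt
  (@lt_gt_pairs_disjoint R)).
congr (_ \x _); apply/seteqP; split => -[[a a'] [b b']];
  rewrite /discordant /lt_pairs /gt_pairs/=.
- case: (ltgtP a b) => [ab|ab|->]; last by rewrite subrr mul0r ltxx.
  + rewrite nmulr_rlt0 ?subr_lt0// subr_gt0 => ab'; by left.
  + rewrite pmulr_rlt0 ?subr_gt0// subr_lt0 => ab'; by right.
- move=> [[ab ab']|[ab ab']].
  + by rewrite nmulr_rlt0 ?subr_lt0 ?subr_gt0.
  + by rewrite pmulr_rlt0 ?subr_gt0 ?subr_lt0.
Qed.

(** With l and g the masses of the two strict orders, the masses to compare are
    the integrals of l^2 + g^2 and of 2 l g, whose difference is the integral
    of (l - g)^2, which is 4 (Psi - 1/2)^2. *)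
Lemma concordance_eq_discordance d (U : measurableType d) (R : realType)
  (mu : probability U R) (k : R.-pker U ~> R)
  (nu : probability (R * R)%type R) :
  (forall A, measurable A -> nu A = \int[mu]_x kprod k k x A) ->
  (nu \x nu) (@concordant R) = (nu \x nu) (@discordant R) <->
  {ae mu \x mu, forall x, relative_effect (k x.1) (k x.2) - 1 / 2 = 0}%R.
Proof.
move=> nuE.
pose D (x : U * U) := (relative_effect (k x.1) (k x.2) - 1 / 2)%R.
apply: (iff_trans _ (integral_sqr_eq0 (mu \x mu)
  (measurable_relative_effect k))).
rewrite -[\int[_]_x _]/(\int[mu \x mu]_x (D x ^+ 2)%:E).
have mD2 : measurable_fun [set: U * U] (fun x => (D x ^+ 2)%:E).
  apply/measurable_EFinP/measurable_funX.
  exact: measurable_relative_effect.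
pose K := kprod (kpull (@measurable_fst _ _ U U) (kprod k k))
                (kpull (@measurable_snd _ _ U U) (kprod k k)).
have mK : measurable_fun [set: U * U] (K ^~ (@discordant R)).
  by apply: measurable_kernel; exact: measurable_discordant.
have concE : (nu \x nu) (@concordant R) =
    4%:E * \int[mu \x mu]_x (D x ^+ 2)%:E + (nu \x nu) (@discordant R).
  rewrite (product_of_mixturesE nuE nuE (@measurable_concordant R)).
  rewrite (product_of_mixturesE nuE nuE (@measurable_discordant R)).
  have <- : \int[mu \x mu]_x (4%:E * (D x ^+ 2)%:E + K x (@discordant R)) =
      4%:E * \int[mu \x mu]_x (D x ^+ 2)%:E +
      \int[mu \x mu]_x (klaw (kprod k k) x.1 \x klaw (kprod k k) x.2)
        (@discordant R).
    rewrite ge0_integralD//.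
    - rewrite ge0_integralZl//; first by move=> x _; rewrite lee_fin sqr_ge0.
    - by move=> x _; rewrite mule_ge0// lee_fin sqr_ge0.
    - exact: measurable_funeM.
  apply: eq_integral => x _.
  rewrite -[K x _]/((klaw (kprod k k) x.1 \x klaw (kprod k k) x.2) _).
  rewrite (product_concordant (klaw k x.1) (klaw k x.2)).
  rewrite (product_discordant (klaw k x.1) (klaw k x.2)).
  pose m : probability (R * R)%type R := klaw k x.1 \x klaw k x.2.
  (* 4 D^2 + 2 l g = (l - g)^2 + 2 l g = l^2 + g^2. *)
  have -> : D x = ((fine (m (@lt_pairs R)) - fine (m (@gt_pairs R))) / 2)%R.
    exact: (relative_effect_half (klaw k x.1) (klaw k x.2)).
  rewrite -[klaw k x.1 \x klaw k x.2]/(m : set (R * R) -> \bar R).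
  have := probability_fin_num m (@measurable_lt_pairs R).
  have := probability_fin_num m (@measurable_gt_pairs R).
  move: (m (@lt_pairs R)) (m (@gt_pairs R)) => [a| |] [b| |]// _ _ /=.
  rewrite -!EFinM -!EFinD; congr EFin.
  by field.
(* The mass of discordance is finite, hence can be cancelled. *)
rewrite concE.
have : (nu \x nu) (@discordant R) \is a fin_num.
  by apply: (probability_fin_num (nu \x nu)); exact: measurable_discordant.
have : 0 <= \int[mu \x mu]_x (D x ^+ 2)%:E.
  by apply: integral_ge0 => x _; rewrite lee_fin sqr_ge0.
case: ((nu \x nu) _) => [r| |]// + _.
case: (integral _ _ _) => [s| |]//= s0.
- rewrite -EFinM -EFinD; split => [[sr]|[->]]; last by rewrite mulr0 add0r.
  by congr EFin; lra.
- by rewrite mulry gtr0_sg// mul1e.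
Qed.

(** * Joint laws of random variables *)

Definition pairRV {d d1 d2} {T : measurableType d} {V : measurableType d1}
  {W : measurableType d2} (f : {mfun T >-> V}) (g : {mfun T >-> W}) :
  T -> V * W := fun t => (f t, g t).

Lemma measurable_pairRV d d1 d2 (T : measurableType d)
  (V : measurableType d1) (W : measurableType d2)
  (f : {mfun T >-> V}) (g : {mfun T >-> W}) :
  measurable_fun [set: T] (pairRV f g).
Proof. exact: measurable_fun_pair. Qed.

HB.instance Definition _ d d1 d2 (T : measurableType d)
  (V : measurableType d1) (W : measurableType d2)
  (f : {mfun T >-> V}) (g : {mfun T >-> W}) :=
  isMeasurableFun.Build _ _ _ _ (pairRV f g) (measurable_pairRV f g).

(** Both sides are measures, hence it is enough to compare them on rectangles,
    where conditional independence gives the claim as soon as k is also a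
    version of the conditional distribution of Y'.  That is where the almost
    sure equality of the two conditional laws enters. *)
Lemma markov_product_law d (T : measurableType d) d' (U : measurableType d')
  (R : realType) (P : probability T R) (X : {RV P >-> U})
  (Y Y' : {RV P >-> R}) (k : R.-pker U ~> R) :
  markov_product X Y Y' -> is_cond_distribution X Y k ->
  forall C, measurable C ->
  distribution P (pairRV Y Y') C = \int[distribution P X]_x kprod k k x C.
Proof.
move=> [[k1 [k2 [k1Y k2Y' k21]]] YY'] kY.
have fink (l : R.-pker U ~> R) x B : measurable B -> (fine (l x B))%:E = l x B.
  by move=> mB; rewrite fineK//; exact: (probability_fin_num (klaw l x)).
(* k is compared with the version k2 for Y' through the version k1 for Y:
   both k and k1 represent P (X in A, Y in B). *)
have kY' : is_cond_distribution X Y' k.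
  move=> B mB; split; first by case: (kY B mB).
  move=> A mA; have [_ ->//] := k2Y' B mB.
  have [_ <-//] := kY B mB; have [_ ->//] := k1Y B mB.
  under eq_integral do rewrite fink//.
  under [RHS]eq_integral do rewrite fink//.
  apply: ae_eq_integral => //.
  - exact/measurable_funTS/measurable_kernel.
  - exact/measurable_funTS/measurable_kernel.
  - by apply: filterS k21 => x /(_ B mB) + _.
apply: (measure_eq_rectangles (m1 := distribution P (pairRV Y Y'))
  (m2 := mixture (distribution P X) (kprod k k))).
move=> A B mA mB; rewrite mixtureE.
(* Integrated over the whole space, the conditional product rule becomes the
   value of the joint law on A `*` B. *)
have [_ /(_ setT measurableT)] := YY' _ _ _ _ mA mB (kY A mA) (kY' B mB).
rewrite preimage_setT setTI => YYE.
transitivity (P (Y @^-1` A `&` Y' @^-1` B)); first by [].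
rewrite YYE; apply: eq_integral => x _.
by rewrite EFinM !fink// [RHS](product_measure1E (klaw k x) (klaw k x)).
Qed.

(** Independence is the product rule on rectangles, which determines a joint
    law on all measurable sets. *)
Lemma law_of_independent_pair d d1 d2 (T : measurableType d)
  (V : measurableType d1) (W : measurableType d2) (R : realType)
  (Q : probability T R) (f : {mfun T >-> V}) (g : {mfun T >-> W})
  (n1 : probability V R) (n2 : probability W R) :
  (forall A, measurable A -> Q (f @^-1` A) = n1 A) ->
  (forall A, measurable A -> Q (g @^-1` A) = n2 A) ->
  independent Q f g ->
  forall C, measurable C -> Q (pairRV f g @^-1` C) = (n1 \x n2) C.
Proof.
move=> fn1 gn2 fg C mC.
apply/esym/(product_measure_unique (m' := distribution Q (pairRV f g))) => //.
move=> A B mA mB; rewrite -[RHS]/(n1 A * n2 B) -fn1// -gn2//.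
exact: fg.
Qed.

(** * The diagonal and the coefficient of separation *)

(** The section of the complement of the diagonal at x is the complement of x;
    a complement of mass zero forces almost all of its sections to be null,
    hence at least one. *)
Lemma diagonal_atom d (U : measurableType d) (R : realType)
  (mu : probability U R) :
  measurable [set x : U * U | x.1 = x.2] ->
  (mu \x mu) [set x | x.1 = x.2] = 1 ->
  exists x, mu (~` [set x]) = 0.
Proof.
move=> mdiag diag1.
pose N : set (U * U) := ~` [set x | x.1 = x.2].
have mN : measurable N by exact: measurableC.
pose m : probability (U * U)%type R := mu \x mu.
have : m N = 0.
  have m1 : m [set x | x.1 = x.2] = 1 by exact: diag1.
  by rewrite probability_setC// m1 subee.
rewrite -[m N]/(\int[mu]_x mu (xsection N x)).
rewrite (eq_integral (fun x => `|mu (xsection N x)|)); last first.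
  by move=> x _; rewrite gee0_abs.
rewrite ae_eq_integral_abs//; last exact: measurable_fun_xsection.
move=> ae0.
have mu0 : 0 < mu setT by rewrite probability_setT.
have muF := ae_properfilter_algebraOfSetsType mu0.
have [x /(_ I) x0] := @filter_ex _ _ muF _ ae0.
exists x; rewrite -[RHS]x0; congr (mu _).
by apply/seteqP; split => y; rewrite /xsection/= inE /N/= => xy /esym.
Qed.

Lemma measurable_tuple_diagonal (R : realType) (p : nat) :
  measurable [set x : p.-tuple R * p.-tuple R | x.1 = x.2].
Proof.
rewrite (_ : mkset _ = \bigcap_(i in [set: 'I_p])
  [set x : p.-tuple R * p.-tuple R | tnth x.1 i = tnth x.2 i]); last first.
  apply/seteqP; split => [x /= xx i _ /=|x H /=]; first by rewrite xx.
  by apply: eq_from_tnth => i; exact: H.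
apply: fin_bigcap_measurable => // i _.
have mf := measurableT_comp (@measurable_tnth _ R p i)
  (@measurable_fst _ _ (p.-tuple R) (p.-tuple R)).
have mg := measurableT_comp (@measurable_tnth _ R p i)
  (@measurable_snd _ _ (p.-tuple R) (p.-tuple R)).
have := measurable_fun_pair mf mg measurableT (@measurable_eq_pairs R).
by rewrite setTI.
Qed.

(** An atom of mass one of the law of X would make every coordinate of X
    almost surely constant. *)
Lemma diagonal_neq1 d (T : measurableType d) (R : realType) (p : nat)
  (P : probability T R) (X : {RV P >-> p.-tuple R}) :
  (exists i : 'I_p, ~ degenerate P (fun t => tnth (X t) i)) ->
  (distribution P X \x distribution P X) [set x | x.1 = x.2] <> 1.
Proof.
move=> [i Xi] diag1; apply: Xi.
have [x x0] := diagonal_atom (@measurable_tuple_diagonal R p) diag1.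
exists (tnth x i); exists (X @^-1` (~` [set x])); split => //.
- rewrite -[X in measurable X]setTI; apply: measurable_funPT => //.
  apply: measurableC.
  have := measurable_xsection x (@measurable_tuple_diagonal R p).
  congr measurable; apply/seteqP.
  by split => y; rewrite /xsection/= inE/= => /esym.
- move=> t /= Xt Xtx; by apply: Xt; rewrite Xtx.
Qed.

(** On the diagonal the relative effect is 1/2 by symmetry, so that the
    restriction to distinct points is harmless. *)
Lemma ae_stochastically_comparable d (T : measurableType d) (R : realType)
  (p : nat) (P : probability T R) (X : {RV P >-> p.-tuple R})
  (k : R.-pker (p.-tuple R) ~> R) :
  stochastically_comparable X k <->
  {ae distribution P X \x distribution P X, forall x,
    relative_effect (k x.1) (k x.2) - 1 / 2 = 0}%R.
Proof.
split; apply: filterS => -[x y] /= H.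
  have [->|xy] := pselect (x = y); last by rewrite H// subrr.
  apply/eqP; rewrite subr_eq0; apply/eqP.
  exact: (relative_effect_refl (klaw k y)).
by move=> _; apply/eqP; rewrite -subr_eq0; apply/eqP.
Qed.

(** The prefactor is nonzero since the diagonal has mass less than one, and
    the real-valued integral vanishes only if the integral does, which is
    finite because the integrand is bounded. *)
Lemma separation_coef_eq0 d (T : measurableType d) (R : realType) (p : nat)
  (P : probability T R) (X : {RV P >-> p.-tuple R})
  (k : R.-pker (p.-tuple R) ~> R) :
  (exists i : 'I_p, ~ degenerate P (fun t => tnth (X t) i)) ->
  separation_coef X k = 0%R <->
  {ae distribution P X \x distribution P X, forall x,
    relative_effect (k x.1) (k x.2) - 1 / 2 = 0}%R.
Proof.
move=> /diagonal_neq1 diag; rewrite /separation_coef.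
pose m : probability (p.-tuple R * p.-tuple R)%type R :=
  distribution P X \x distribution P X.
apply: (iff_trans _ (integral_sqr_eq0 m (measurable_relative_effect k))).
rewrite -[X in fine X]/(m [set x | x.1 = x.2]).
have c0 : (4 / (1 - fine (m [set x | x.1 = x.2])) != 0 :> R)%R.
  rewrite mulf_neq0// invr_eq0 subr_eq0 eq_sym; apply/eqP => m1.
  apply: diag; rewrite -[LHS]/(m [set x | x.1 = x.2]).
  rewrite -[LHS]fineK ?m1//; apply: probability_fin_num.
  exact: measurable_tuple_diagonal.
have intfin : \int[m]_x
    ((relative_effect (k x.1) (k x.2) - 1 / 2) ^+ 2)%:E \is a fin_num.
  rewrite ge0_fin_numE; last first.
    by apply: integral_ge0 => x _; rewrite lee_fin sqr_ge0.
  apply: (@le_lt_trans _ _ (\int[m]_x 1)).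
    apply: ge0_le_integral => //.
    - by move=> x _; rewrite lee_fin sqr_ge0.
    - apply/measurable_EFinP/measurable_funX.
      exact: measurable_relative_effect.
    - move=> x _; rewrite lee_fin.
      by have /andP[] := relative_effect_bound (klaw k x.1) (klaw k x.2).
  by rewrite integral_cst// mul1e (le_lt_trans (probability_le1 m _))// ltry.
split => [/eqP|int0].
  rewrite mulf_eq0 (negbTE c0)/= => /eqP int0.
  by rewrite -[LHS]fineK// [fine _]int0.
apply/eqP; rewrite mulf_eq0 (negbTE c0)/=; apply/eqP.
exact: (congr1 fine int0).
Qed.

Local Close Scope ereal_scope.

Theorem corollary2p3 (R : realType) (p : nat)
    (d : measure_display) (T : measurableType d) (P : probability T R)
    (X : {RV P >-> p.-tuple R}) (Y Y' : {RV P >-> R})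
    (Y_nondegenerate : ~ degenerate P Y)
    (X_nondegenerate :
       exists i : 'I_p, ~ degenerate P (fun t => tnth (X t) i))
    (YY'_markov : markov_product X Y Y')
    (* a version of the conditional distribution of Y given X *)
    (k : R.-pker (p.-tuple R) ~> R) (k_version : is_cond_distribution X Y k)
    (* independent copies (Y1, Y1') and (Y2, Y2') of (Y, Y') *)
    (d' : measure_display) (T' : measurableType d') (Q : probability T' R)
    (Y1 Y1' Y2 Y2' : {RV Q >-> R})
    (copy1 : same_distribution P Q (fun t => (Y t, Y' t))
                                   (fun t => (Y1 t, Y1' t)))
    (copy2 : same_distribution P Q (fun t => (Y t, Y' t))
                                   (fun t => (Y2 t, Y2' t)))
    (copies_independent : independent Q (fun t => (Y1 t, Y1' t))
                                        (fun t => (Y2 t, Y2' t))) :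
  (separation_coef X k = 0 <-> stochastically_comparable X k) /\
  (stochastically_comparable X k <->
     Q [set t | (Y1 t - Y2 t) * (Y1' t - Y2' t) > 0] =
     Q [set t | (Y1 t - Y2 t) * (Y1' t - Y2' t) < 0]).
Proof.
have comparable_ae := ae_stochastically_comparable X k.
split.
  exact: (iff_trans (separation_coef_eq0 k X_nondegenerate)
    (iff_sym comparable_ae)).
apply: (iff_trans comparable_ae); apply: iff_sym.
have lawE := law_of_independent_pair (f := pairRV Y1 Y1')
  (g := pairRV Y2 Y2') (n1 := distribution P (pairRV Y Y'))
  (n2 := distribution P (pairRV Y Y')) (fun A mA => esym (copy1 A mA))
  (fun A mA => esym (copy2 A mA)) copies_independent.
rewrite -[Q [set t | _ > 0]]/(Q (pairRV (pairRV Y1 Y1') (pairRV Y2 Y2') @^-1`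
  @concordant R)).
rewrite -[Q [set t | _ < 0]]/(Q (pairRV (pairRV Y1 Y1') (pairRV Y2 Y2') @^-1`
  @discordant R)).
rewrite (lawE _ (@measurable_concordant R)) (lawE _ (@measurable_discordant R)).
exact: (concordance_eq_discordance (markov_product_law YY'_markov k_version)).
Qed.
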